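(* Let $F$ be algebraically closed, let $1\le r\le k=\binom{m}{l}$, and let $B\subset GL(m,F)$ be the Borel subgroup of upper triangular matrices with respect to the basis $e_1,\dots,e_m$ of $V$. The Schubert unions of spanning dimension $r$ define the fixed points of the action of $B$ on $G(r,V_l)$; that is, an $r$-dimensional subspace of $V_l=\wedge^l V$ is a fixed point of $B$ on $G(r,V_l)$ if and only if it is equal to $L(S_U)$ for some Schubert union $S_U\subset G(l,m)$ with $\dim L(S_U)=r$.
   Context: Let $1\le l<m$ be integers, $V$ an $m$-dimensional $F$-vector space with basis $e_1,\dots,e_m$, and $A_i=\mathrm{Span}(e_1,\dots,e_i)$. $G(l,m)\subset\mathbf P(\wedge^l V)$ is the Grassmann variety of $l$-dimensional subspaces of $V$ in its Plücker embedding. For $\alpha=(a_1,\dots,a_l)$ with $1\le a_1<\dots<a_l\le m$, the Schubert cycle is $S_\alpha=\{W\in G(l,m):\dim(W\cap A_{a_i})\ge i,\ i=1,\dots,l\}$. A Schubert union is a finite union of Schubert cycles with respect to this fixed flag. For $M\subset G(l,m)$, $L(M)\subset\wedge^l V$ denotes the linear span of the affine cone over $M$; the spanning dimension of a Schubert union $S_U$ is $\dim L(S_U)$. $G(r,V_l)$ is the Grassmann variety of $r$-dimensional subspaces of $V_l=\wedge^l V$. The group $GL(m,F)$ acts on $V$ from the left, hence linearly on $V_l$, on $\wedge^r V_l$, and on $G(r,V_l)$; $B$ is the subgroup stabilizing the flag $A_1\subset\dots\subset A_m$. *)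

(* Defs.v *)
From HB Require Import structures.
From mathcomp Require Import all_boot all_order all_algebra.
From mathcomp Require Import boolp classical_sets.

Set Implicit Arguments.
Unset Strict Implicit.
Unset Printing Implicit Defensive.

Import GRing.Theory.

Local Open Scope ring_scope.
Local Open Scope classical_set_scope.

Definition linspan (F : fieldType) (E : vectType F) (S : set E) : {vspace E} :=
  xget 0%VS [set L : {vspace E} |
    (forall x, S x -> x \in L) /\
    (forall L' : {vspace E}, (forall x, S x -> x \in L') -> (L <= L')%VS)].

Lemma linspan_ex (F : fieldType) (E : vectType F) (S : set E) :
  exists2 s : seq E, (forall x, x \in s -> S x) & (forall x, S x -> x \in <<s>>%VS).
Proof.
pose P n := exists2 s : seq E, (forall x, x \in s -> S x) & \dim <<s>> = n.
have P0 : exists n, `[< P n >].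
  by exists 0; apply/asboolP; exists [::] => //; rewrite span_nil dimv0.
have Pub n : `[< P n >] -> (n <= \dim {:E})%N.
  by move/asboolP => [s _ <-]; apply: dimvS; apply: subvf.
have [n /asboolP [s sS sn] nmax] := ex_maxnP P0 Pub.
exists s => // x Sx.
have le_n : (\dim <<x :: s>> <= n)%N.
  apply: nmax; apply/asboolP; exists (x :: s) => // y.
  by rewrite inE => /orP [/eqP -> | /sS].
have sub : (<<s>> <= <<x :: s>>)%VS.
  by apply: sub_span => y ys; rewrite inE ys orbT.
have /eqP <- : (<<x :: s>>)%VS == (<<s>>)%VS.
  by rewrite eq_sym eqEdim sub sn.
by apply: memv_span; rewrite inE eqxx.
Qed.

Lemma linspanP (F : fieldType) (E : vectType F) (S : set E) :
  (forall x, S x -> x \in linspan S) /\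
  (forall L : {vspace E}, (forall x, S x -> x \in L) -> (linspan S <= L)%VS).
Proof.
rewrite /linspan; case: xgetP => [L -> // | none].
have [s sS Ss] := linspan_ex S.
case: (none <<s>>%VS); split => // L' SL'.
by apply/span_subvP => x /sS /SL'.
Qed.

Section ExteriorPower.
Variables (F : fieldType) (V : vectType F) (l : nat).

Definition tset (v : l.-tuple V) (i : 'I_l) (x : V) : l.-tuple V :=
  [tuple if j == i then x else tnth v j | j < l].

Definition multilinear (U : vectType F) (f : l.-tuple V -> U) : Prop :=
  forall (v : l.-tuple V) (i : 'I_l) (a : F) (x y : V),
    f (tset v i (a *: x + y)) = a *: f (tset v i x) + f (tset v i y).

Definition alternating (U : vectType F) (f : l.-tuple V -> U) : Prop :=
  multilinear f /\
  (forall (v : l.-tuple V) (i j : 'I_l),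
     i != j -> tnth v i = tnth v j -> f v = 0).

(* The l-th exterior power of V, given by its universal property: it is
   determined up to a unique isomorphism, and [exterior_power_exists] below
   shows that it exists for every V and l. *)
Record exterior_power := ExteriorPower {
  ext_space :> vectType F;
  wedge : l.-tuple V -> ext_space;
  wedge_alternating : alternating wedge;
  ext_lift : forall (U : vectType F) (f : l.-tuple V -> U),
    alternating f -> 'Hom(ext_space, U);
  ext_liftE : forall (U : vectType F) (f : l.-tuple V -> U)
    (hf : alternating f) (v : l.-tuple V), ext_lift hf (wedge v) = f v;
  ext_hom_eq : forall (U : vectType F) (h1 h2 : 'Hom(ext_space, U)),
    (forall v, h1 (wedge v) = h2 (wedge v)) -> h1 = h2
}.

Lemma map_tset (g : 'End(V)) (v : l.-tuple V) (i : 'I_l) (x : V) :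
  map_tuple g (tset v i x) = tset (map_tuple g v) i (g x).
Proof.
apply: eq_from_tnth => j; rewrite tnth_map !tnth_mktuple tnth_map.
by case: (j == i).
Qed.

Lemma wedge_map_alternating (E : exterior_power) (g : 'End(V)) :
  alternating (fun v => wedge E (map_tuple g v)).
Proof.
have [hM hA] := wedge_alternating E; split=> [v i a x y | v i j ij vij].
  by rewrite !map_tset linearP hM.
by apply: (hA _ i j) => //; rewrite !tnth_map vij.
Qed.

(* The l-th exterior power of g, i.e. the endomorphism of E mapping
   v_1 /\ ... /\ v_l to g v_1 /\ ... /\ g v_l. *)
Definition ext_map (E : exterior_power) (g : 'End(V)) : 'End(E) :=
  ext_lift E (wedge_map_alternating E g).

Lemma ext_mapE (E : exterior_power) (g : 'End(V)) (v : l.-tuple V) :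
  ext_map E g (wedge E v) = wedge E (map_tuple g v).
Proof. exact: ext_liftE. Qed.

End ExteriorPower.

Arguments wedge {F V l} e v.
Arguments ext_map {F V l} E g.

Section ExteriorPowerExists.
Variables (F : fieldType) (V : vectType F) (l : nat).

Local Notation n := (\dim {:V}).
Local Notation b := (vbasis {:V}).
Local Notation idx := {ffun 'I_l -> 'I_n}.
Local Notation T := {ffun idx -> F^o}.

Definition btuple (p : idx) : l.-tuple V := [tuple b`_(p i) | i < l].

(* T is the l-th tensor power of V in coordinates, and [tens v] the pure
   tensor of v; the exterior power is the quotient of T by [tens_rel], realized
   on a complement. *)
Definition tens (v : l.-tuple V) : T :=
  [ffun p : idx => \prod_(i < l) coord b (p i) (tnth v i)].

Definition tens_rel : {vspace T} :=
  linspan [set t | exists v i j,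
    [/\ i != j, tnth v i = tnth v j & t = tens v]].

Lemma tset_id (v : l.-tuple V) i : tset v i (tnth v i) = v.
Proof.
by apply: eq_from_tnth => j; rewrite tnth_mktuple; case: eqP => [->|].
Qed.

Lemma tens_multilinear : multilinear tens.
Proof.
move=> v i a x y; apply/ffunP => p; rewrite !ffunE.
have E z : \prod_(j < l) coord b (p j) (tnth (tset v i z) j) =
    coord b (p i) z * \prod_(j < l | j != i) coord b (p j) (tnth v j).
  rewrite (bigD1 i) //= tnth_mktuple eqxx; congr (_ * _).
  by apply: eq_bigr => j /negPf ji; rewrite tnth_mktuple ji.
by rewrite !E linearP mulrDl -mulrA.
Qed.

Lemma multilinear_sum (U : vectType F) (f : l.-tuple V -> U)
    (hf : multilinear f) v i m (c : 'I_m -> F) (x : 'I_m -> V) :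
  f (tset v i (\sum_k c k *: x k)) = \sum_k c k *: f (tset v i (x k)).
Proof.
have f0 : f (tset v i 0) = 0.
  by have := hf v i (-1) 0 0; rewrite scaler0 addr0 scaleN1r addNr.
elim: m c x => [|m IH] c x; first by rewrite !big_ord0.
by rewrite !big_ord_recl hf IH.
Qed.

Lemma multilinear_eq0 (U : vectType F) (f : l.-tuple V -> U) :
  multilinear f -> (forall p, f (btuple p) = 0) -> forall v, f v = 0.
Proof.
move=> hf f0 v.
suff H k : (k <= l)%N -> forall v,
    (forall i : 'I_l, (k <= i)%N -> exists q : 'I_n, tnth v i = b`_q) ->
    f v = 0.
  by apply: (H l) => // i; rewrite leqNgt ltn_ord.
elim: k => [_ {}v bv | k IH kl {}v bv].
  have /fin_all_exists [p pv] : forall i, exists q : 'I_n, tnth v i = b`_q.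
    by move=> i; apply: bv.
  rewrite (_ : v = btuple (finfun p)) //.
  by apply: eq_from_tnth => i; rewrite tnth_mktuple ffunE pv.
pose i := Ordinal kl.
rewrite -(tset_id v i) (coord_vbasis (memvf (tnth v i))) multilinear_sum //.
rewrite big1 // => q _; rewrite IH ?scaler0 //; first exact: ltnW.
move=> j kj; rewrite tnth_mktuple; case: eqP => [_|/eqP ne]; first by exists q.
apply: bv; rewrite ltn_neqAle kj andbT.
by apply: contraNneq ne => e; apply/eqP/val_inj.
Qed.

Lemma tens_btuple p : tens (btuple p) = [ffun q => (q == p)%:R].
Proof.
apply/ffunP => q; rewrite !ffunE.
have [->|qp] := eqVneq q p.
  rewrite big1 // => i _.
  by rewrite tnth_mktuple coord_free ?eqxx // (basis_free (vbasisP _)).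
have [i qpi] : exists i, q i != p i.
  apply/existsP; apply: contraNT qp => /existsPn qp; apply/eqP/ffunP => i.
  by apply/eqP; have := qp i; rewrite negbK.
apply/eqP; rewrite prodf_seq_eq0; apply/hasP; exists i; first by rewrite mem_index_enum.
rewrite tnth_mktuple coord_free ?(basis_free (vbasisP _)) //=.
by rewrite eq_sym in qpi; rewrite (negPf qpi) eqxx.
Qed.

Section Lift.
Variables (U : vectType F) (f : l.-tuple V -> U).

Definition tens_lift_fun (t : T) : U := \sum_p t p *: f (btuple p).

Lemma tens_lift_linear : linear tens_lift_fun.
Proof.
move=> a s t; rewrite /tens_lift_fun scaler_sumr -big_split /=.
by apply: eq_bigr => p _; rewrite !ffunE scalerDl scalerA.
Qed.

HB.instance Definition _ := GRing.isSemilinear.Build F T U _ tens_lift_fun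
  (GRing.semilinear_linear tens_lift_linear).

Definition tens_lift : 'Hom(T, U) := linfun tens_lift_fun.

Lemma tens_liftE : multilinear f -> forall v, tens_lift (tens v) = f v.
Proof.
move=> hf v; apply/eqP; rewrite -subr_eq0; apply/eqP.
pose d v := tens_lift (tens v) - f v; rewrite -/(d v).
apply: multilinear_eq0 => {v} [v i a x y | p]; rewrite /d.
  rewrite tens_multilinear hf linearP scalerBr opprD.
  by rewrite addrACA.
rewrite lfunE /= /tens_lift_fun tens_btuple (bigD1 p) //= ffunE eqxx scale1r.
rewrite big1 ?addr0 ?subrr // => q /negPf qp.
by rewrite ffunE qp scale0r.
Qed.

End Lift.

Lemma tens_lift_rel (U : vectType F) (f : l.-tuple V -> U) (t : T) :
  alternating f -> t \in tens_rel -> tens_lift f t = 0.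
Proof.
move=> [hf fA] tK; apply/eqP; rewrite -memv_ker; apply: subvP tK.
apply: (linspanP _).2 => x [v [i [j [ij vij ->]]]].
by rewrite memv_ker tens_liftE // (fA v i j ij vij).
Qed.

Local Notation E0 := (subvs_of (tens_rel^C)%VS).

Definition quot_fun (t : T) : E0 :=
  vsproj (tens_rel^C)%VS (t - projv tens_rel t).

Lemma quot_linear : linear quot_fun.
Proof.
move=> a s t; rewrite /quot_fun -linearP; congr (vsproj _ _).
by rewrite linearP scalerBr opprD addrACA.
Qed.

HB.instance Definition _ := GRing.isSemilinear.Build F T E0 _ quot_fun
  (GRing.semilinear_linear quot_linear).

Definition quot : 'Hom(T, E0) := linfun quot_fun.

Lemma vsval_quot t : vsval (quot t) = t - projv tens_rel t.
Proof. by rewrite lfunE /= /quot_fun vsprojK // memv_projC. Qed.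

Lemma quot_alternating : alternating (fun v => quot (tens v)).
Proof.
split=> [v i a x y | v i j ij vij]; first by rewrite tens_multilinear linearP.
apply: val_inj; rewrite /= vsval_quot projv_id ?subrr ?linear0 //.
by apply: (linspanP _).1; exists v, i, j.
Qed.

Definition quot_lift (U : vectType F) (f : l.-tuple V -> U)
  (hf : alternating f) : 'Hom(E0, U) := (tens_lift f \o linfun vsval)%VF.

Lemma quot_liftE (U : vectType F) (f : l.-tuple V -> U) (hf : alternating f) v :
  quot_lift hf (quot (tens v)) = f v.
Proof.
rewrite comp_lfunE.
have -> : linfun vsval (quot (tens v)) = vsval (quot (tens v)) by exact: lfunE.
rewrite vsval_quot linearB /= tens_liftE; last by case: hf.
by rewrite (tens_lift_rel hf) ?subr0 // memv_proj.
Qed.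

Lemma quot_hom_eq (U : vectType F) (h1 h2 : 'Hom(E0, U)) :
  (forall v, h1 (quot (tens v)) = h2 (quot (tens v))) -> h1 = h2.
Proof.
move=> h12; apply/lfunP => x.
have [t ->] : exists t, x = quot t.
  exists (vsval x); apply: val_inj; rewrite /= vsval_quot.
  have : vsval x \in lker (projv tens_rel) by rewrite lker_proj subvsP.
  by rewrite memv_ker => /eqP ->; rewrite subr0.
have -> : t = \sum_p t p *: tens (btuple p).
  apply/ffunP => q; rewrite sum_ffunE (bigD1 q) //= tens_btuple !ffunE eqxx.
  rewrite big1 ?addr0 => [|p /negPf pq]; first by rewrite [RHS]mulr1.
  by rewrite tens_btuple !ffunE eq_sym pq [LHS]mulr0.
rewrite !linear_sum; apply: eq_bigr => p _.
by rewrite !linearZ /= h12.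
Qed.

Theorem exterior_power_exists : inhabited (exterior_power V l).
Proof.
exact: (inhabits (ExteriorPower quot_alternating quot_liftE quot_hom_eq)).
Qed.

End ExteriorPowerExists.

Definition grassmannian (F : fieldType) (d : nat) (E : vectType F) :
  set {vspace E} := [set W | \dim W = d].
Arguments grassmannian {F} d E.

Section Schubert.
Variables (F : fieldType) (V : vectType F) (m : nat) (e : m.-tuple V).

Definition gl_fun (g : 'M[F]_m) (v : V) : V :=
  \sum_j coord e j v *: \sum_i g i j *: e`_i.

Lemma gl_fun_linear g : linear (gl_fun g).
Proof.
move=> a u v; rewrite /gl_fun scaler_sumr -big_split /=.
by apply: eq_bigr => j _; rewrite linearP scalerDl scalerA.
Qed.

HB.instance Definition _ g := GRing.isSemilinear.Build F V V _ (gl_fun g)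
  (GRing.semilinear_linear (gl_fun_linear g)).

Definition gl_act (g : 'M[F]_m) : 'End(V) := linfun (gl_fun g).

Lemma gl_actE (g : 'M[F]_m) (j : 'I_m) :
  basis_of {:V} e -> gl_act g e`_j = \sum_i g i j *: e`_i.
Proof.
move=> /basis_free e_free; rewrite lfunE /= /gl_fun (bigD1 j) //=.
rewrite coord_free // eqxx scale1r.
rewrite [X in _ + X]big1 ?addr0 // => k /negPf kj.
by rewrite coord_free // eq_sym kj scale0r.
Qed.

Definition borel : set 'M[F]_m :=
  [set g | g \in unitmx /\ (forall i j : 'I_m, (j < i)%N -> g i j = 0)].

Definition flag (i : nat) : {vspace V} := <<take i e>>%VS.

Definition schubert_index (l : nat) (a : l.-tuple nat) : bool :=
  sorted ltn a && all (fun x => 0 < x <= m)%N a.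

(* The entries of a are 1-based, as in the flag, but their positions i : 'I_l
   are 0-based, hence i.+1. *)
Definition schubert_cycle (l : nat) (a : l.-tuple nat) : set {vspace V} :=
  [set W | grassmannian l V W /\
    (forall i : 'I_l, (i.+1 <= \dim (W :&: flag (tnth a i)))%N)].

Definition schubert_union (l : nat) (M : set {vspace V}) : Prop :=
  exists2 s : seq (l.-tuple nat), all (@schubert_index l) s &
    M = \bigcup_(a in [set` s]) schubert_cycle a.

(* The affine cone over the image of M under the Pluecker embedding, which
   sends W = Span(w_1, ..., w_l) to the line through w_1 /\ ... /\ w_l. *)
Definition affine_cone (l : nat) (E : exterior_power V l)
    (M : set {vspace V}) : set E :=
  [set x | exists W c (w : l.-tuple V),
    [/\ M W, basis_of W w & x = c *: wedge E w]].

Definition lin_span (l : nat) (E : exterior_power V l)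
    (M : set {vspace V}) : {vspace E} :=
  linspan (@affine_cone l E M).

Definition grass_act (l : nat) (E : exterior_power V l) (g : 'M[F]_m)
    (L : {vspace E}) : {vspace E} :=
  (ext_map E (gl_act g) @: L)%VS.

Definition borel_fixed (l : nat) (E : exterior_power V l)
    (L : {vspace E}) : Prop :=
  forall g, borel g -> grass_act g L = L.

End Schubert.

Arguments schubert_index m {l} a.
Arguments schubert_union {F V m} e l M.
Arguments affine_cone {F V l} E M.
Arguments lin_span {F V l} E M.
Arguments grass_act {F V m} e {l E} g L.

(* Main.v *)
Require Import Defs.
From mathcomp Require Import all_boot all_order all_fingroup all_algebra.
From mathcomp Require Import boolp classical_sets.

Set Implicit Arguments.
Unset Strict Implicit.
Unset Printing Implicit Defensive.

Import GRing.Theory.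

Local Open Scope ring_scope.

(** An exterior power of V is spanned by the vectors e_p = e_(p_1) /\ ... /\ e_(p_l).
A family of operators moves between them: for i <= j and a scalar c with
c <> 0 and c <> -1, the matrix 1 + c E_ij lies in the Borel group, and
[raise c i j], which is (its action minus the identity) / c, replaces the entry
j of e_p by i if j occurs once in p, and kills e_p if j does not occur.  It
preserves every subspace fixed by the Borel group.  As each operator changes a
single entry, no divided powers arise, and the argument is the same in every
characteristic.

Let L be fixed.  For i = j the operators are the commuting projectors given by
the torus; splitting every vector of L with them, coordinate by coordinate,
ends in lines through some e_a with a increasing, so L is spanned by the e_a it
contains ([stable_span]).  For i < j they show that the set of these a is
closed downwards: if e_a is in L and p_i <= a_i for all i, then e_p is in L
([bwedge_down]).

It remains to compare L with the span of the union of the Schubert cycles S_a,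
for the increasing a with e_a in L.  The coordinate subspace with Pluecker
vector e_a lies in S_a ([coordinate_schubert]), so L is contained in that span.
Conversely a subspace W in S_a has a basis whose i-th vector lies in
A_(a_i); expanding its wedge by multilinearity yields only e_p with
p_i <= a_i ([schubert_cone_sub]), and another basis of W changes the wedge by a
scalar ([alternating_line]).  Hence the span is contained in L.

In the other direction, the Borel group preserves the flag, so it maps each
Schubert cycle to itself and therefore fixes the span of any union of them
([lin_span_fixed]). *)

(** * Alternating maps *)

Section Alternating.
Variables (F : fieldType) (V U : vectType F) (l : nat).
Implicit Types (f : l.-tuple V -> U) (v w : l.-tuple V) (K : {vspace U}).

(** The membership form of expanding a product of sums, replacing one argument
    at a time by an element of the corresponding spanning list. *)
Lemma multilinear_span f K (X : 'I_l -> seq V) :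
    multilinear f ->
    (forall w, (forall i, tnth w i \in X i) -> f w \in K) ->
  forall v, (forall i, tnth v i \in <<X i>>%VS) -> f v \in K.
Proof.
move=> hf fK.
suff H k : (k <= l)%N -> forall v, (forall i, tnth v i \in <<X i>>%VS) ->
    (forall i : 'I_l, (k <= i)%N -> tnth v i \in X i) -> f v \in K.
  by move=> v hv; apply: (H l) => // i; rewrite leqNgt ltn_ord.
elim: k => [_ v _ hv | k IH kl v hs hX]; first by apply: fK => i; exact: hv.
pose i := Ordinal kl.
rewrite -(tset_id v i) (coord_span (X := in_tuple (X i)) (hs i)).
rewrite (multilinear_sum hf); apply: memv_suml => q _; apply: memvZ.
have Xq : (in_tuple (X i))`_q \in X i by exact: mem_nth.
apply: IH => [|j|j kj]; first exact: ltnW.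
  by rewrite tnth_mktuple; case: eqP => [->|_]; [exact: memv_span | exact: hs].
rewrite tnth_mktuple; case: eqP => [->|/eqP ji] //.
by apply: hX; rewrite ltn_neqAle kj andbT; apply: contraNneq ji => kj'; apply/eqP/val_inj.
Qed.

Lemma multilinearD f v i x y : multilinear f ->
  f (tset v i (x + y)) = f (tset v i x) + f (tset v i y).
Proof. by move=> hf; have := hf v i 1 x y; rewrite !scale1r. Qed.

Lemma tset_comm v i j x y : i != j ->
  tset (tset v i x) j y = tset (tset v j y) i x.
Proof.
move=> ij; apply: eq_from_tnth => k; rewrite !tnth_mktuple.
by case: (eqVneq k j) => [->|//]; rewrite eq_sym (negPf ij).
Qed.

(** Expand 0 = f (.., x + y, .., x + y, ..). *)
Lemma alternating_swap f v i j x y : alternating f -> i != j ->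
  f (tset (tset v i x) j y) = - f (tset (tset v i y) j x).
Proof.
move=> [hf hA] ij; apply/eqP; rewrite -addr_eq0; apply/eqP.
have f0 z : f (tset (tset v i z) j z) = 0.
  by apply: (hA _ i j) => //; rewrite !tnth_mktuple eqxx (negPf ij) eqxx.
have := f0 (x + y).
rewrite multilinearD // ![tset (tset v i (x + y)) j _]tset_comm //.
rewrite !multilinearD // -!(tset_comm _ _ _ ij) !f0.
by rewrite add0r addr0 addrC.
Qed.

(** The sign of s is left unspecified because only the line through f w
    matters; this makes the induction on a product of transpositions free of
    sign bookkeeping. *)
Lemma alternating_perm f w (s : {perm 'I_l}) :
  alternating f -> f [tuple tnth w (s i) | i < l] \in <[f w]>%VS.
Proof.
move=> hf; have [ts -> /allP dts] := prod_tpermP s.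
elim: ts w dts => [|[x y] ts IH] w dts.
  rewrite big_nil (_ : [tuple _ | _ < _] = w) ?memv_line //.
  by apply: eq_from_tnth => i; rewrite tnth_mktuple perm1.
have xy : x != y by exact: (dts (x, y) (mem_head _ _)).
set s' := (\prod_(t <- ts) tperm t.1 t.2)%g in IH.
rewrite big_cons; pose w' := [tuple tnth w (s' i) | i < l].
have fw' : f w' \in <[f w]>%VS.
  by apply: IH => t tts; apply: dts; rewrite inE tts orbT.
rewrite (_ : [tuple _ | _ < _] = tset (tset w' x (tnth w' y)) y (tnth w' x)).
  rewrite alternating_swap // memvN.
  by rewrite tset_id tset_id.
apply: eq_from_tnth => i; rewrite !tnth_mktuple permM /=.
case: tpermP => [->|->|/eqP/negPf -> /eqP/negPf ->] //.
  by rewrite eqxx (negPf xy).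
by rewrite eqxx.
Qed.

(** The substitute for the determinant formula of a change of basis. *)
Lemma alternating_line f v w : alternating f ->
  (forall i, tnth v i \in <<w>>%VS) -> f v \in <[f w]>%VS.
Proof.
move=> hf; have [hM hA] := hf.
apply: (@multilinear_span f _ (fun=> w)) => // {}v vw.
have /fin_all_exists [s vs] : forall i, exists k, tnth v i = tnth w k.
  by move=> i; have /tnthP [k] := vw i; exists k.
case: (injectiveP s) => [s_inj | /injectiveP/injectivePn [i [j ij sij]]].
  rewrite (_ : v = [tuple tnth w (perm s_inj i) | i < l]).
    exact: alternating_perm.
  by apply: eq_from_tnth => i; rewrite tnth_mktuple permE.
by rewrite (hA v i j ij) ?mem0v // !vs sij.
Qed.

End Alternating.

(** Projecting onto K agrees with the identity on all wedges, hence everywhere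
    by the uniqueness in the universal property. *)
Lemma wedge_span_full (F : fieldType) (V : vectType F) (l : nat)
    (E : exterior_power V l) (K : {vspace E}) :
  (forall v, wedge E v \in K) -> K = fullv.
Proof.
move=> EK.
have h : projv K = \1%VF.
  by apply: ext_hom_eq => v; rewrite projv_id // id_lfunE.
by apply/vspaceP => x; rewrite memvf -[x]id_lfunE -h memv_proj.
Qed.

(** * Increasing index tuples *)

Section Increasing.
Variables (l m : nat).
Implicit Types a p : l.-tuple 'I_m.

Lemma increasing_tnth a (i j : 'I_l) :
  sorted ltn (map val a) -> (i < j)%N -> (tnth a i < tnth a j)%N.
Proof.
move=> a_inc ij; have := sorted_ltn_nth ltn_trans 0%N a_inc.
move/(_ i j); rewrite !inE size_map size_tuple !ltn_ord => /(_ isT isT ij).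
by rewrite -!(tnth_nth 0%N (map_tuple val a)) !tnth_map.
Qed.

Lemma increasing_uniq a : sorted ltn (map val a) -> uniq a.
Proof. by rewrite ltn_sorted_uniq_leq (map_inj_uniq val_inj) => /andP []. Qed.

Lemma exists_increasing p : uniq p ->
  exists2 a : l.-tuple 'I_m, sorted ltn (map val a) & a =i p.
Proof.
move=> up; exists (sort_tuple (relpre val leq) p) => [|i]; last exact: mem_sort.
rewrite ltn_sorted_uniq_leq map_inj_uniq ?sort_uniq ?up; last exact: val_inj.
by rewrite sorted_map; apply: sort_sorted => i j; exact: leq_total.
Qed.

End Increasing.

(** * Root operators on the exterior power *)

Section Frame.
Variables (F : fieldType) (V : vectType F) (m : nat) (e : m.-tuple V).
Hypothesis he : basis_of {:V}%VS e.

Lemma mem_span_frame (v : V) : v \in <<e>>%VS.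
Proof. by rewrite (span_basis he) memvf. Qed.

Definition upper (a : F) (i j : 'I_m) : 'M[F]_m := 1%:M + a *: delta_mx i j.

Lemma borel_upper a (i j : 'I_m) : (i <= j)%N -> 1 + a != 0 -> borel (upper a i j).
Proof.
move=> ij a1; have upE r s : upper a i j r s = (r == s)%:R + a * ((r == i) && (s == j))%:R.
  by rewrite !mxE.
have up0 (r s : 'I_m) : (s < r)%N -> upper a i j r s = 0.
  move=> sr; rewrite upE.
  have -> : (r == s) = false by apply/negbTE; rewrite -val_eqE /= neq_ltn sr orbT.
  case: andP => [[/eqP ri /eqP sj]|_]; last by rewrite mulr0 addr0.
  by move: sr; rewrite ri sj ltnNge ij.
split=> //; rewrite -unitmx_tr unitmxE det_trig; last first.
  by apply/is_trig_mxP => r s rs; rewrite mxE up0.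
rewrite unitfE; apply/prodf_neq0 => r _; rewrite mxE upE eqxx.
by case: (_ && _); rewrite ?mulr1 // mulr0 addr0 oner_neq0.
Qed.

Lemma gl_act_upper a (i j k : 'I_m) :
  gl_act e (upper a i j) e`_k = e`_k + (a * (k == j)%:R) *: e`_i.
Proof.
rewrite gl_actE //.
rewrite (eq_bigr (fun r : 'I_m => (r == k)%:R *: e`_r +
    (a * ((r == i) && (k == j))%:R) *: e`_r)); last first.
  by move=> r _; rewrite !mxE scalerDl.
rewrite big_split /= (bigD1 k) //= eqxx scale1r big1 ?addr0; last first.
  by move=> r /negPf ->; rewrite scale0r.
rewrite (bigD1 i) //= eqxx /= big1 ?addr0 // => r /negPf ->.
by rewrite mulr0 scale0r.
Qed.

Section Wedge.
Variables (l : nat) (E : exterior_power V l).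
Implicit Types (a p q : l.-tuple 'I_m) (L K : {vspace E}).

Definition btup p : l.-tuple V := map_tuple (fun i : 'I_m => e`_i) p.
Definition bwedge p : E := wedge E (btup p).

Lemma tnth_btup p k : tnth (btup p) k = e`_(tnth p k).
Proof. by rewrite tnth_map. Qed.

Lemma bwedge_nuniq p : ~~ uniq p -> bwedge p = 0.
Proof.
move=> np; have : ~~ injectiveb (tnth p).
  by apply: contra np => /injectiveP/tuple_uniqP.
case/injectivePn => i [j ij pij]; apply: (wedge_alternating E).2 ij _.
by rewrite !tnth_btup pij.
Qed.

(** In particular e_p depends on the set of entries of p only up to a scalar:
    this is why increasing tuples suffice to index a spanning family. *)
Lemma bwedge_line p q : {subset p <= q} -> bwedge p \in <[bwedge q]>%VS.
Proof.
move=> pq; apply: alternating_line; first exact: wedge_alternating.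
move=> i; rewrite tnth_btup; apply: memv_span.
by apply: (map_f (fun i : 'I_m => e`_i)); apply/pq/mem_tnth.
Qed.

Lemma bwedge_full K : (forall p, bwedge p \in K) -> K = fullv.
Proof.
move=> pK; apply: wedge_span_full => v.
apply: (@multilinear_span _ _ _ _ (wedge E) K (fun=> e)).
- exact: (wedge_alternating E).1.
- move=> w we.
  have /fin_all_exists [p wp] : forall i, exists k, tnth w i = tnth e k.
    by move=> i; have /tnthP [k] := we i; exists k.
  rewrite (_ : w = btup [tuple p i | i < l]) ?pK //.
  by apply: eq_from_tnth => i; rewrite tnth_btup tnth_mktuple wp (tnth_nth 0).
- by move=> i; exact: mem_span_frame.
Qed.

(** As [raise_in] shows, this is the root vector E_ij of the Lie algebra acting
    as a derivation, on those e_p in which j occurs at most once.  It is obtained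
    from a group element since the hypothesis on subspaces is about the group. *)
Definition raise (c : F) (i j : 'I_m) : 'End(E) :=
  c^-1 *: (ext_map E (gl_act e (upper c i j)) - \1%VF).

Lemma raise_stable L c (i j : 'I_m) x : borel_fixed e L ->
  (i <= j)%N -> 1 + c != 0 -> x \in L -> raise c i j x \in L.
Proof.
move=> fL ij c1 xL; rewrite /raise scale_lfunE add_lfunE opp_lfunE id_lfunE.
apply/memvZ/memvB => //.
by rewrite -(fL _ (borel_upper ij c1)); apply: memv_img.
Qed.

Lemma raise_notin c i j p : j \notin p -> raise c i j (bwedge p) = 0.
Proof.
move=> jp; rewrite /raise scale_lfunE add_lfunE opp_lfunE id_lfunE ext_mapE.
rewrite (_ : map_tuple _ _ = btup p) ?subrr ?scaler0 //.
apply: eq_from_tnth => k; rewrite tnth_map tnth_btup gl_act_upper.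
case: eqP => [kj|_]; first by rewrite -kj mem_tnth in jp.
by rewrite mulr0 scale0r addr0.
Qed.

Lemma raise_in c i j p k : c != 0 -> tnth p k = j ->
    (forall k', tnth p k' = j -> k' = k) ->
  raise c i j (bwedge p) =
    bwedge [tuple if k' == k then i else tnth p k' | k' < l].
Proof.
move=> c0 pk pj; rewrite /raise scale_lfunE add_lfunE opp_lfunE id_lfunE ext_mapE.
have -> : map_tuple (gl_act e (upper c i j)) (btup p) =
    tset (btup p) k (c *: e`_i + e`_j).
  apply: eq_from_tnth => k'; rewrite tnth_map tnth_mktuple tnth_btup gl_act_upper.
  case: (eqVneq k' k) => [->|k'k]; first by rewrite pk eqxx mulr1 addrC.
  case: eqP => [/pj/eqP|_]; first by rewrite (negPf k'k).
  by rewrite mulr0 scale0r addr0.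
rewrite ((wedge_alternating E).1) -pk -tnth_btup tset_id addrK scalerA mulVf // scale1r.
congr (wedge _ _); apply: eq_from_tnth => k'.
by rewrite tnth_btup !tnth_mktuple tnth_btup; case: eqP.
Qed.

(** Entries are changed from left to right.  The order matters: when the k-th
    entry a_k is about to become p_k, the entries before it are at most
    a_1, .., a_(k-1), and those after it exceed a_k, so a_k occurs only once and
    [raise_in] applies, even when p has repeated entries. *)
Lemma bwedge_down L a p : (exists c : F, c != 0 /\ 1 + c != 0) ->
    borel_fixed e L -> sorted ltn (map val a) ->
    (forall i, tnth p i <= tnth a i)%N -> bwedge a \in L ->
  bwedge p \in L.
Proof.
move=> [c [c0 c1]] fL a_inc pa aL.
have a_lt := increasing_tnth a_inc.
pose mix k := [tuple if (i < k)%N then tnth p i else tnth a i | i < l].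
suff H k : (k <= l)%N -> bwedge (mix k) \in L.
  have <- : mix l = p by apply: eq_from_tnth => i; rewrite tnth_mktuple ltn_ord.
  exact: H.
elim: k => [_ | k IH kl].
  by rewrite (_ : mix 0%N = a) //; apply: eq_from_tnth => i; rewrite tnth_mktuple.
pose i := Ordinal kl.
have mixi : tnth (mix k) i = tnth a i by rewrite tnth_mktuple ltnn.
have mix1 j : tnth (mix k) j = tnth a i -> j = i.
  rewrite tnth_mktuple => /(congr1 val) /= aij; apply/val_inj/eqP => /=.
  case: ltngtP aij => // jk aij.
    by have := pa j; rewrite aij leqNgt a_lt.
  by have := a_lt i j jk; rewrite aij ltnn.
have := raise_stable fL (pa i) c1 (IH (ltnW kl)).
rewrite (raise_in _ c0 mixi mix1).
congr (bwedge _ \in L); apply: eq_from_tnth => j; rewrite !tnth_mktuple ltnS.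
rewrite [(j <= k)%N]leq_eqVlt -val_eqE /=.
by case: (eqVneq (j : nat) k) => [/(@val_inj _ _ _ j i) ->|].
Qed.

(** Lines through different e_a have different weights for the torus; since L is
    stable under the weight projectors it is the sum of its weight lines.  The
    projectors of the m coordinates are applied one after the other. *)
Lemma stable_span L K : (exists c : F, c != 0 /\ 1 + c != 0) ->
    borel_fixed e L ->
    (forall a, sorted ltn (map val a) -> bwedge a \in L -> bwedge a \in K) ->
  (L <= K)%VS.
Proof.
move=> [c [c0 c1]] fL LK.
(* W k T is spanned by the e_p whose entries k, k + 1, ... are known to be those
   in T; it is everything for k = m and at most a line for k = 0. *)
pose cond k (T : {set 'I_m}) p :=
  uniq p && [forall i : 'I_m, (k <= i)%N ==> ((i \in p) == (i \in T))].
pose W k T := <<[seq bwedge p | p <- enum (@predT (l.-tuple 'I_m)) & cond k T p]>>%VS.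
have W_in k T p : cond k T p -> bwedge p \in W k T.
  by move=> kp; apply/memv_span/map_f; rewrite mem_filter kp mem_enum.
have W_img k T k' T' (h : 'End(E)) :
    (forall p, cond k T p -> h (bwedge p) \in W k' T') ->
    forall x, x \in W k T -> h x \in W k' T'.
  move=> hW x xW; rewrite memv_preim; apply: subvP x xW.
  apply/span_subvP => _ /mapP [p + ->]; rewrite mem_filter => /andP [kp _].
  by rewrite -memv_preim hW.
suff H k : (k <= m)%N -> forall T x, x \in L -> x \in W k T -> x \in K.
  apply/subvP => x xL; apply: (H m _ finset.set0) => //.
  rewrite (bwedge_full (K := W m finset.set0)) ?memvf // => p.
  case up: (uniq p); last by rewrite bwedge_nuniq ?up ?mem0v.
  apply: W_in; rewrite /cond up /=; apply/forallP => i.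
  by rewrite leqNgt ltn_ord.
elim: k => [_ | k IH km] T x xL xW.
  have [-> | x0] := eqVneq x 0; first exact: mem0v.
  have [p pT] : exists p, cond 0%N T p.
    apply/existsP; apply: contraNT x0 => /existsPn noT.
    move: xW; rewrite /W (@eq_filter _ _ pred0) ?filter_pred0 /= ?span_nil ?memv0 //.
    by move=> p; apply/negbTE.
  have /andP [up /forallP pE] := pT.
  have [a a_inc ap] := exists_increasing up.
  have /vlineP [b xb] : x \in <[bwedge a]>%VS.
    move: (x) xW; apply/subvP/span_subvP => _ /mapP [q + ->].
    rewrite mem_filter => /andP [/andP [_ /forallP qE] _].
    apply: bwedge_line => i; rewrite ap.
    by have /eqP -> := implyP (pE i) isT; have /eqP -> := implyP (qE i) isT.
  have b0 : b != 0 by apply: contraNneq x0 => b0; rewrite xb b0 scale0r.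
  rewrite xb memvZ // LK //.
  by rewrite -[bwedge a]scale1r -(mulVf b0) -scalerA -xb memvZ.
(* P projects onto the e_p containing j, and 1 - P onto the others. *)
pose j := Ordinal km; pose P := raise c j j.
have Pin p : uniq p -> j \in p -> P (bwedge p) = bwedge p.
  move=> up /tnthP [i pi]; rewrite /P (@raise_in _ _ _ _ i) //.
    congr bwedge; apply: eq_from_tnth => i'; rewrite tnth_mktuple.
    by case: eqP => [->|].
  by move=> i'; rewrite pi; move/tuple_uniqP: up; apply.
have PL : P x \in L by exact: raise_stable.
rewrite -(subrK (P x) x); apply: memvD.
  apply: (IH (ltnW km) (T :\ j)); first exact: memvB.
  have -> : x - P x = (\1 - P)%VF x by rewrite add_lfunE opp_lfunE id_lfunE.
  apply: W_img xW => p /andP [up /forallP pT].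
  rewrite add_lfunE opp_lfunE id_lfunE.
  have [jp | jp] := boolP (j \in p); first by rewrite Pin // subrr mem0v.
  rewrite /P raise_notin // subr0; apply: W_in; rewrite /cond up /=.
  apply/forallP => i; apply/implyP; rewrite leq_eqVlt in_setD1.
  case: (eqVneq i j) => [-> _|ij]; first by rewrite (negPf jp).
  case/orP => [/eqP ki|ki]; last exact: (implyP (pT i) ki).
  by case/eqP: ij; apply: val_inj.
apply: (IH (ltnW km) (j |: T)) => //.
apply: W_img xW => p /andP [up /forallP pT].
have [jp | jp] := boolP (j \in p); last by rewrite /P raise_notin // mem0v.
rewrite Pin //; apply: W_in; rewrite /cond up /=.
apply/forallP => i; apply/implyP; rewrite leq_eqVlt in_setU1.
case: (eqVneq i j) => [-> _|ij]; first by rewrite jp.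
case/orP => [/eqP ki|ki]; last exact: (implyP (pT i) ki).
by case/eqP: ij; apply: val_inj.
Qed.

End Wedge.

(** * Schubert cycles *)

Section Schubert.
Variable l : nat.
Implicit Types (a : l.-tuple 'I_m) (W : {vspace V}).

(** Entries of Schubert indices are 1-based. *)
Definition index_of a : l.-tuple nat := map_tuple (fun i : 'I_m => i.+1) a.

Lemma schubert_index_of a :
  sorted ltn (map val a) -> schubert_index m (index_of a).
Proof.
move=> a_inc; apply/andP; split; last first.
  by apply/allP => _ /mapP [i _ ->]; rewrite /= ltn_ord.
by rewrite /= sorted_map; rewrite sorted_map in a_inc.
Qed.

Lemma free_btup a : uniq a -> free (btup a).
Proof.
have e_free := basis_free he; have e_uniq := free_uniq e_free.
move=> ua; rewrite (@perm_free _ _ _ [seq x <- e | x \in btup a]) ?filter_free //.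
apply: uniq_perm; rewrite ?filter_uniq //.
  rewrite map_inj_in_uniq // => i j _ _ /eqP.
  by rewrite nth_uniq ?size_tuple // => /eqP/val_inj.
move=> x; rewrite mem_filter; case xa: (x \in _) => //=.
by case/mapP: xa => i _ ->; rewrite mem_nth ?size_tuple.
Qed.

Lemma mem_flag (i : 'I_m) n : (i < n)%N -> e`_i \in flag e n.
Proof.
move=> lt_in; apply: memv_span; rewrite -(nth_take 0 lt_in); apply: mem_nth.
by rewrite size_take size_tuple; case: ifP => // _; exact: ltn_ord.
Qed.

Lemma coordinate_schubert a : sorted ltn (map val a) ->
  schubert_cycle e (index_of a) <<btup a>>%VS.
Proof.
move=> a_inc; have fa := free_btup (increasing_uniq a_inc); split=> [|i].
  by rewrite /grassmannian /= (eqP fa) size_tuple.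
have fi : free (take i.+1 (btup a)).
  by apply: (@catl_free _ _ (drop i.+1 (btup a))); rewrite cat_take_drop.
have <- : \dim <<take i.+1 (btup a)>> = i.+1.
  by rewrite (eqP fi) size_takel // size_tuple.
apply: dimvS; apply/span_subvP => x xi; rewrite memv_cap memv_span ?(mem_take xi) //=.
have [j ji ->] : exists2 j : 'I_l, (j <= i)%N & x = e`_(tnth a j).
  have xl := xi; rewrite -index_mem size_takel ?size_tuple // in xl.
  have jl := leq_trans xl (ltn_ord i); exists (Ordinal jl) => //.
  rewrite -tnth_btup (tnth_nth 0) /= -(nth_take 0 xl) nth_index //.
apply: mem_flag; rewrite tnth_map ltnS.
move: ji; rewrite leq_eqVlt => /predU1P [/val_inj -> // | ji].
exact/ltnW/(increasing_tnth a_inc).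
Qed.

End Schubert.
End Frame.

(** Each U i is too large to lie in the span of the i vectors chosen before. *)
Lemma free_selection (F : fieldType) (V : vectType F) (n : nat) (U : nat -> {vspace V}) :
    (forall i, (i < n)%N -> (i < \dim (U i))%N) ->
  exists w : n.-tuple V, free w /\ forall i : 'I_n, tnth w i \in U i.
Proof.
elim: n => [|n IH] dU; first by exists [tuple]; split=> [|[]//]; exact: nil_free.
have [|w [fw wU]] := IH; first by move=> i /ltnW; exact: dU.
have /subvPn [u uU uw] : ~~ (U n <= <<w>>)%VS.
  apply/negP => /dimvS; rewrite (eqP fw) size_tuple leqNgt.
  by rewrite dU.
exists [tuple of rcons w u]; split.
  by rewrite (@perm_free _ _ _ (u :: w)) ?perm_rcons // free_cons uw.
move=> i; rewrite (tnth_nth 0) nth_rcons size_tuple.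
have := ltn_ord i; rewrite ltnS leq_eqVlt => /predU1P [->|lt_in].
  by rewrite ltnn eqxx.
by rewrite lt_in -(tnth_nth 0 w (Ordinal lt_in)); exact: wU.
Qed.

(** * Linear spans of Schubert unions *)

Section SchubertSpan.
Variables (F : fieldType) (V : vectType F) (m : nat) (e : m.-tuple V).
Hypothesis he : basis_of {:V}%VS e.
Variables (l : nat) (E : exterior_power V l).

(** The Schubert conditions provide a basis of W adapted to the flag, whose wedge
    involves only the e_p below a. *)
Lemma schubert_cone_sub (K : {vspace E}) (a : l.-tuple 'I_m) W (w : l.-tuple V) :
    (forall p : l.-tuple 'I_m, (forall i, tnth p i <= tnth a i)%N ->
       bwedge e E p \in K) ->
    schubert_cycle e (index_of a) W -> basis_of W w -> wedge E w \in K.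
Proof.
move=> pK [dW Wa] bw.
pose U i := (W :&: flag e (nth 0%N (index_of a) i))%VS.
have [i il|w' [fw' w'U]] := @free_selection _ V l U.
  by have := Wa (Ordinal il); rewrite (tnth_nth 0%N).
have bw' : basis_of W w'.
  rewrite basisEfree fw' /= [\dim W]dW size_tuple leqnn andbT.
  apply/span_subvP => _ /tnthP [i ->].
  by have := w'U i; rewrite memv_cap => /andP [].
have : wedge E w \in <[wedge E w']>%VS.
  apply: alternating_line; first exact: wedge_alternating.
  by move=> i; rewrite (span_basis bw') (basis_mem bw) ?mem_tnth.
apply/subvP; rewrite -memvE.
apply: (@multilinear_span _ _ _ _ (wedge E) K (fun i => take (tnth a i).+1 e)).
- exact: (wedge_alternating E).1.
- move=> v ve; have /fin_all_exists [p vp] : forall i, exists k : 'I_m,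
      (k <= tnth a i)%N /\ tnth v i = e`_k.
    move=> i; have vi := ve i; have lt := vi.
    rewrite -index_mem size_takel ?size_tuple // in lt.
    exists (Ordinal (leq_trans lt (ltn_ord (tnth a i)))); split=> //=.
    by rewrite -(nth_take 0 lt) nth_index.
  rewrite (_ : v = btup e [tuple p i | i < l]).
    by apply: pK => i; rewrite tnth_mktuple; case: (vp i).
  by apply: eq_from_tnth => i; rewrite tnth_btup tnth_mktuple; case: (vp i).
- move=> i; have := w'U i; rewrite memv_cap => /andP [_].
  by rewrite /flag -tnth_nth tnth_map.
Qed.

Lemma borel_flag g i : borel g -> (gl_act e g @: flag e i <= flag e i)%VS.
Proof.
move=> [_ gB]; rewrite /flag limg_span; apply/span_subvP => _ /mapP [x xi ->].
have lt := xi; rewrite -index_mem in lt.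
have ltm : (index x (take i e) < m)%N.
  by apply: leq_trans lt _; rewrite size_take size_tuple; case: ltnP => // /ltnW.
have lti : (index x (take i e) < i)%N.
  by apply: leq_trans lt _; rewrite size_take size_tuple; case: ltnP => // /ltnW.
have -> : x = e`_(Ordinal ltm) by rewrite /= -(nth_take 0 lti) nth_index.
rewrite gl_actE //; apply: memv_suml => r _.
case: (ltnP (Ordinal ltm) r) => [/gB ->|rj]; first by rewrite scale0r mem0v.
by apply/memvZ/mem_flag/(leq_ltn_trans rj).
Qed.

Lemma gl_act_mul g h v : gl_act e g (gl_act e h v) = gl_act e (g *m h) v.
Proof.
rewrite (coord_span (mem_span_frame he v)) !linear_sum; apply: eq_bigr => j _.
rewrite !linearZ /=; congr (_ *: _); rewrite !gl_actE // linear_sum /=.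
under eq_bigr do rewrite linearZ /= gl_actE // scaler_sumr.
rewrite exchange_big /=; apply: eq_bigr => i _; rewrite mxE scaler_suml.
by apply: eq_bigr => k _; rewrite scalerA mulrC.
Qed.

Lemma gl_act1 v : gl_act e 1%:M v = v.
Proof.
rewrite {1}(coord_span (mem_span_frame he v)) linear_sum [RHS](coord_span (mem_span_frame he v)).
apply: eq_bigr => j _; rewrite linearZ /= gl_actE //; congr (_ *: _).
rewrite (bigD1 j) //= mxE eqxx scale1r big1 ?addr0 // => i /negPf ij.
by rewrite mxE ij scale0r.
Qed.

Lemma gl_act_ker0 g : g \in unitmx -> lker (gl_act e g) == 0%VS.
Proof.
move=> gU; apply/lker0P/(can_inj (g := gl_act e (invmx g))) => v.
by rewrite gl_act_mul mulVmx // gl_act1.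
Qed.

(** By functoriality, the inverse is induced by the inverse matrix. *)
Lemma ext_map_gl_ker0 g : g \in unitmx -> lker (ext_map E (gl_act e g)) == 0%VS.
Proof.
move=> gU; apply/lker0P/(can_inj (g := ext_map E (gl_act e (invmx g)))) => x.
rewrite -comp_lfunE -[RHS]id_lfunE; congr (fun_of_lfun _ x).
apply: ext_hom_eq => v; rewrite comp_lfunE !ext_mapE id_lfunE; congr wedge.
by apply: eq_from_tnth => i; rewrite !tnth_map gl_act_mul mulVmx // gl_act1.
Qed.

Lemma schubert_cycle_borel g (a : l.-tuple nat) W : borel g ->
  schubert_cycle e a W -> schubert_cycle e a (gl_act e g @: W)%VS.
Proof.
move=> gB [dW Wa]; have gk := gl_act_ker0 gB.1.
have dimg (U : {vspace V}) : \dim (gl_act e g @: U) = \dim U.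
  by apply: limg_dim_eq; rewrite (eqP gk) capv0.
split=> [|i]; first by rewrite /grassmannian /= dimg.
apply: leq_trans (Wa i) _; rewrite -dimg; apply: dimvS.
apply: subv_trans (limg_cap _ _ _) _; apply: capvS => //; exact: borel_flag.
Qed.

(** Stability of the affine cone gives one inclusion; the other one follows by
    comparing dimensions, as the action is injective. *)
Lemma lin_span_fixed M : schubert_union e l M -> borel_fixed e (lin_span E M).
Proof.
move=> [s _ ->] g gB; rewrite /grass_act.
set L := lin_span E _; set h := ext_map E _.
have hk : lker h == 0%VS by exact: ext_map_gl_ker0 gB.1.
apply/eqP; rewrite eqEdim (limg_dim_eq (f := h)) ?leqnn ?andbT; last first.
  by rewrite (eqP hk) capv0.
apply/subvP => _ /memv_imgP [x xL ->]; rewrite memv_preim; apply: subvP x xL.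
apply: (linspanP _).2 => _ [W [c [w [[a sa Wa] bw ->]]]]; rewrite -memv_preim.
apply: (linspanP _).1; exists (gl_act e g @: W)%VS, c, (map_tuple (gl_act e g) w).
split; first by exists a => //; exact: schubert_cycle_borel.
  by apply: limg_basis_of => //; rewrite (eqP (gl_act_ker0 gB.1)) capv0.
by rewrite linearZ /= ext_mapE.
Qed.

Lemma borel_fixed_union (L : {vspace E}) : (exists c : F, c != 0 /\ 1 + c != 0) ->
  borel_fixed e L -> exists2 M, schubert_union e l M & L = lin_span E M.
Proof.
move=> hc fL.
pose D := [seq a : l.-tuple 'I_m <- enum predT |
  sorted ltn (map val a) && (bwedge e E a \in L)].
exists (\bigcup_(a in [set` map (@index_of m l) D]) schubert_cycle e a)%classic.
  exists (map (@index_of m l) D) => //; rewrite all_map; apply/allP => a.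
  by rewrite mem_filter => /andP [/andP [a_inc _] _]; exact: schubert_index_of.
apply/eqP; rewrite eqEsubv; apply/andP; split.
  apply: (stable_span he hc fL) => a a_inc aL; apply: (linspanP _).1.
  exists <<btup e a>>%VS, 1, (btup e a); split; last by rewrite scale1r.
    exists (index_of a); last exact: coordinate_schubert.
    by rewrite /= map_f // mem_filter a_inc aL mem_enum.
  by rewrite /basis_of eqxx (free_btup he (increasing_uniq a_inc)).
apply: (linspanP _).2 => _ [W [c [w [[b /= /mapP [a + ->] Wa] bw ->]]]].
rewrite mem_filter => /andP [/andP [a_inc aL] _]; apply: memvZ.
apply: (schubert_cone_sub _ Wa bw) => p pa; exact: (bwedge_down he hc fL a_inc).
Qed.

End SchubertSpan.

(** Any field with more than two elements has such a scalar; here it is a root of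
    c (1 + c) = 1. *)
Lemma closed_field_scalar (F : closedFieldType) : exists c : F, c != 0 /\ 1 + c != 0.
Proof.
have [c] := solve_monicpoly (fun i => if i == 0%N then 1 else -1 : F) (ltn0Sn 1).
rewrite !big_ord_recr big_ord0 /= add0r mulr1 expr1 mulN1r expr2 => cc.
have c1 : c * (1 + c) = 1 by rewrite mulrDr mulr1 cc addrCA subrr addr0.
have : c * (1 + c) != 0 by rewrite c1 oner_neq0.
by rewrite mulf_eq0 negb_or => /andP [c0 c1']; exists c.
Qed.

Theorem proposition2p7 (F : closedFieldType) (l m r : nat)
    (hlm : (1 <= l < m)%N) (hr : (1 <= r <= 'C(m, l))%N)
    (V : vectType F) (e : m.-tuple V) (he : basis_of {:V}%VS e)
    (Vl : exterior_power V l) (L : {vspace Vl}) (hL : grassmannian r Vl L) :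
  borel_fixed e L <->
  exists M : set {vspace V},
    schubert_union e l M /\
    \dim (lin_span Vl M) = r /\
    L = lin_span Vl M.
Proof.
split=> [fL | [M [uM [_ ->]]]]; last exact: lin_span_fixed.
have [M uM LM] := borel_fixed_union he (closed_field_scalar F) fL.
by exists M; rewrite -LM; split=> //; split.
Qed.
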